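(* Any cyclic permutation of the levels of the cyclic base position gives a solution. That is, for every integer $n\ge 1$ and every integer $s$, the set $\{(i,j,k)\in[n]^3 : i+j-k\equiv 1-s \pmod n\}$ is a solution in $[n]^3$.
   Context: $[n]^3$ denotes the graph whose vertices (also called cubes) are the triples $(i,j,k)$ with $i,j,k\in\{1,\dots,n\}$; two vertices are neighbours if they differ in exactly one coordinate, and in that coordinate by exactly $1$. Level $k$ is the set of vertices with third coordinate $k$. A position is any subset of the vertices of $[n]^3$. A dismantling move removes from the current position a vertex having exactly $3$ neighbours in the current position. A base position is a set of $n^2$ pairwise non-neighbouring vertices of $[n]^3$. A solution is a base position that can be obtained from the full position $[n]^3$ by a finite sequence of dismantling moves. The cyclic base position is $\{(i,j,k)\in[n]^3: i+j-k\equiv 1 \pmod n\}$; permuting its levels cyclically by the shift $s$ means that level $k$ becomes level $k+s$ (mod $n$, with representatives in $\{1,\dots,n\}$), which gives the set $\{(i,j,k): i+j-k\equiv 1-s \pmod n\}$. *)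

(* Defs.v *)
From mathcomp Require Import all_boot all_order all_algebra.
From mathcomp Require Import ring.

Set Implicit Arguments.
Unset Strict Implicit.
Unset Printing Implicit Defensive.

Import GRing.Theory.

(* The coordinates 1, ..., n are encoded by 'I_n = {0, ..., n - 1}: the
   triple ((a, b), c) stands for the cube (a + 1, b + 1, c + 1). *)
Definition cube (n : nat) : finType := ('I_n * 'I_n * 'I_n)%type.

Definition coord (n : nat) (a : 'I_n) : nat := a.+1.

Definition consecutive (n : nat) (a b : 'I_n) : bool :=
  (coord a == (coord b).+1) || (coord b == (coord a).+1).

Definition neighbour (n : nat) (u v : cube n) : bool :=
  let: (i, j, k) := u in
  let: (i', j', k') := v in
  [|| [&& consecutive i i', j == j' & k == k'],
      [&& i == i', consecutive j j' & k == k']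
    | [&& i == i', j == j' & consecutive k k']].

Definition dismantling_move (n : nat) (P Q : {set cube n}) : bool :=
  [exists x in P, (#|[set y in P | neighbour x y]| == 3) && (Q == P :\ x)].

Definition base_position (n : nat) (B : {set cube n}) : bool :=
  (#|B| == n ^ 2) && [forall u in B, forall v in B, ~~ neighbour u v].

Definition solution (n : nat) (B : {set cube n}) : bool :=
  base_position B && connect (@dismantling_move n) [set: cube n] B.

Local Open Scope ring_scope.

Definition shifted_cyclic_base (n : nat) (s : int) : {set cube n} :=
  [set v : cube n | let: (i, j, k) := v in
     ((coord i)%:Z + (coord j)%:Z - (coord k)%:Z == 1 - s %[mod n%:Z])%Z].

Definition cyclic_base (n : nat) : {set cube n} :=
  [set v : cube n | let: (i, j, k) := v in
     ((coord i)%:Z + (coord j)%:Z - (coord k)%:Z == 1 %[mod n%:Z])%Z].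

(* Level k of P becomes the level of the result whose index is congruent to
   k + s modulo n. *)
Definition shift_levels (n : nat) (s : int) (P : {set cube n}) : {set cube n} :=
  [set v : cube n | let: (i, j, l) := v in
     [exists k : 'I_n, ((i, j, k) \in P) &&
        ((coord l)%:Z == (coord k)%:Z + s %[mod n%:Z])%Z]].

Lemma shift_levels_cyclic_base (n : nat) (s : int) :
  shift_levels s (cyclic_base n) = shifted_cyclic_base n s.
Proof.
apply/setP => -[[i j] l]; rewrite !inE; apply/existsP/idP => [[k]|].
  rewrite inE => /andP[]; rewrite !eqz_mod_dvd => h1 h2.
  have := rpredB h1 h2; congr (dvdz _ _); ring.
have n0 : n%:Z != 0 by case: n i {j l} => [[]|].
rewrite eqz_mod_dvd => h.
have lt : (`|((coord l)%:Z - s - 1) %% n%:Z|%Z < n)%N.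
  rewrite -ltz_nat gez0_abs ?modz_ge0 // ltz_pmod //.
  by case: n i {j l h n0} => [[]|].
exists (Ordinal lt).
have E : (n %| (coord (Ordinal lt))%:Z - ((coord l)%:Z - s))%Z.
  rewrite /coord /= -addn1 PoszD gez0_abs ?modz_ge0 //.
  set x := (l.+1%:Z - s)%R.
  rewrite (_ : (_ - x = ((x - 1) %% n)%Z - (x - 1))%R); last by ring.
  by rewrite -eqz_mod_dvd modz_mod.
rewrite inE !eqz_mod_dvd; apply/andP; split.
  by have := rpredB h E; congr (dvdz _ _); ring.
by rewrite -rpredN; move: E; congr (dvdz _ _); ring.
Qed.

(* Main.v *)
Require Import Defs.
From mathcomp Require Import all_boot all_order all_algebra.
From mathcomp Require Import zify.

(* In each coordinate direction every line contains exactly one base cube.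
   Orient the edges of each line towards it: a cube outside the base then has
   exactly three out-neighbours, and a base cube has none.  If this orientation
   is acyclic, removing the cubes from the sources down deletes each of them
   when exactly its three out-neighbours are left.

   To see acyclicity, reflect the third coordinate, so that the cubes have
   coordinates (a, b, c) in {0, ..., n - 1}^3 and the base is
   a + b + c + t = 0 mod n, and let h be the residue of a + b + c + t mod n.
   A coordinate a moves down if h <= a and up otherwise, and h moves along with
   it.  If all coordinates are >= h, they all stay so and h decreases; dually if
   all are < h.  In the mixed case max - min never increases, and while it is
   constant only the middle coordinate moves, always in the same direction. *)

Set Implicit Arguments.
Unset Strict Implicit.
Unset Printing Implicit Defensive.

Import GRing.Theory.

(** * Dismantling in order of decreasing rank *)

Lemma connect_dismantling_rank n (B : {set cube n}) (rk : cube n -> nat) :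
    (forall v, (v \in B) = (rk v == 0)) ->
    (forall u v, neighbour u v -> rk u != rk v) ->
    (forall v, v \notin B ->
       #|[set y | neighbour v y & rk y < rk v]| = 3) ->
  connect (@dismantling_move n) [set: cube n] B.
Proof.
move=> rkB rk_neq out3.
(* Induction on the number of cubes left outside [B], over positions closed under lower-ranked
   neighbours. *)
suff: forall m (P : {set cube n}), #|P :\: B| = m -> B \subset P ->
    (forall v y, v \in P -> neighbour v y -> rk y < rk v -> y \in P) ->
    connect (@dismantling_move n) P B.
  by move=> /(_ _ [set: cube n] erefl (subsetT B)); apply=> v y; rewrite !inE.
elim=> [|m IHm] P cardPB sBP closedP.
  have /eqP -> : P == B; last exact: connect0.
  by rewrite eqEsubset sBP andbT -setD_eq0 -cards_eq0 cardPB.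
have [x0 x0P] : exists x, x \in P :\: B.
  by apply/set0Pn; rewrite -cards_eq0 cardPB.
have [x /setDP[xP xNB] x_max] := arg_maxnP rk x0P.
(* Closure keeps all lower neighbours of [x]; maximality of [rk x] rules out higher ones. *)
have inP y : neighbour x y -> (y \in P) = (rk y < rk x).
  move=> xy; apply/idP/idP => [yP|]; last exact: closedP xP xy.
  rewrite ltn_neqAle eq_sym rk_neq //=.
  have [yB|yNB] := boolP (y \in B); last exact/x_max/setDP.
  by move: yB; rewrite rkB => /eqP ->.
apply: connect_trans (connect1 _) (IHm (P :\ x) _ _ _).
- apply/existsP; exists x; rewrite xP eqxx andbT /= -(out3 x xNB).
  apply/eqP/eq_card => y; rewrite !inE andbC.
  by case: (boolP (neighbour x y)) => //= /inP.
- have := cardsD1 x (P :\: B); rewrite cardPB inE xNB xP => -[->].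
  by apply: eq_card => y; rewrite !inE; do !case: (_ \in _);
    rewrite ?andbF ?andbT.
- apply/subsetP=> y yB; rewrite !inE (subsetP sBP) // andbT.
  by apply: contraNneq xNB => <-.
move=> v y; rewrite !inE => /andP[vx vP] vy lt_yv.
rewrite (closedP v) // andbT; apply: contraTneq lt_yv => ->.
have [vB|vNB] := boolP (v \in B).
  by move: vB; rewrite rkB => /eqP ->.
by rewrite -leqNgt; apply/x_max/setDP.
Qed.

(** * A decreasing rank on coordinate triples *)

Definition max3 (a b c : nat) := maxn a (maxn b c).
Definition min3 (a b c : nat) := minn a (minn b c).
Definition mid3 (a b c : nat) := a + b + c - max3 a b c - min3 a b c.

(* A rank strictly decreasing along the orientation; the summand n outside the
   product puts the mixed cubes above the unmixed ones, whose rank is < n. *)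
Definition rank3 (n h a b c : nat) : nat :=
  if h == 0 then 0
  else if h <= min3 a b c then h
  else if max3 a b c < h then n - h
  else n + n * (max3 a b c - min3 a b c)
       + (if h <= mid3 a b c then mid3 a b c else n.-1 - mid3 a b c).

Lemma rank3C n h a b c : rank3 n h a b c = rank3 n h b a c.
Proof.
by rewrite /rank3 /mid3 /max3 /min3 maxnCA minnCA [a + b]addnC.
Qed.

(** With [rank3C] this generates all permutations, so any coordinate can be the moving one. *)
Lemma rank3CA n h a b c : rank3 n h a b c = rank3 n h c a b.
Proof.
by rewrite /rank3 /mid3 /max3 /min3
   [maxn b c]maxnC [minn b c]minnC maxnCA minnCA [a + b + c]addnC addnA.
Qed.

Lemma rank3_eq0 n h a b c : h < n -> (rank3 n h a b c == 0) = (h == 0).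
Proof. rewrite /rank3 => hn; do !case: ifP => //; rewrite ?addn_eq0; lia. Qed.

Lemma rank3_sorted n h a b c : a <= b <= c ->
  rank3 n h a b c =
  if h == 0 then 0 else if h <= a then h else if c < h then n - h
  else n + n * (c - a) + (if h <= b then b else n.-1 - b).
Proof.
move=> abc; rewrite /rank3 /mid3.
have -> : max3 a b c = c by rewrite /max3; lia.
have -> : min3 a b c = a by rewrite /min3; lia.
by have -> : a + b + c - c - a = b by lia.
Qed.

(* One step of the orientation, in the first coordinate. *)
Lemma rank3_lt n h h' a a' b c :
  a < n -> a' < n -> b < n -> c < n -> 0 < h < n ->
  (if h <= a then a = a'.+1 /\ h = h'.+1
   else a' = a.+1 /\ h' = h.+1 %% n) ->
  rank3 n h' a' b c < rank3 n h a b c.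
Proof.
move=> an a'n bn cn /andP[h0 hn] step.
have [h'0|h'0] := posnP h'.
  by rewrite {1}/rank3 h'0 lt0n rank3_eq0 // -lt0n.
(* Only the wrap from n - 1 to 0 needs the modulus, and [h'] is now positive. *)
have {}step : h <= a /\ a = a'.+1 /\ h = h'.+1 \/
              a < h /\ a' = a.+1 /\ h' = h.+1.
  case: (leqP h a) step => ah [ea eh']; [by left | right].
  split=> //; split=> //.
  rewrite eh' modn_small // ltn_neqAle hn andbT.
  by apply: contraTneq h'0 => hSn; rewrite eh' hSn modnn.
wlog bc : b c bn cn / b <= c.
  move=> lt_rank; case: (leqP b c) => [|/ltnW] bc; first exact: lt_rank.
  by rewrite rank3CA rank3C [rank3 n h a b c]rank3CA
    [rank3 n h c a b]rank3C lt_rank.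
(* A change of the spread outweighs the last summand of the rank, which is below n. *)
have mulD D' D : D' < D -> n * D' + n <= n * D.
  by move=> ltD; rewrite -mulnSr leq_mul2l ltD orbT.
(* As [a] and [a'] differ by 1, they are both minimal, both middle or both maximal. *)
have [sb|bs] := ltnP (minn a a') b.
- rewrite !rank3_sorted; try lia.
  have := mulD (c - a') (c - a); have := mulD (c - a) (c - a').
  move: (n * (c - a')) (n * (c - a)) => x y.
  by do !case: ifP; lia.
have [sc|cs] := ltnP (minn a a') c.
- rewrite rank3C [rank3 n h a b c]rank3C !rank3_sorted; try lia.
  move: (n * _) => x.
  by do !case: ifP; lia.
- rewrite -rank3CA -[rank3 n h a b c]rank3CA !rank3_sorted; try lia.
  have := mulD (a' - b) (a - b); have := mulD (a - b) (a' - b).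
  move: (n * (a' - b)) (n * (a - b)) => x y.
  by do !case: ifP; lia.
Qed.

(* rev_ord on the third coordinate turns the base condition on i + j - k into
   one on a sum. *)
Definition height n (t : nat) (v : cube n) : nat :=
  (v.1.1 + v.1.2 + rev_ord v.2 + t) %% n.

Definition cube_rank n t (v : cube n) : nat :=
  rank3 n (height t v) v.1.1 v.1.2 (rev_ord v.2).

(** * Ranks along a line *)

Lemma modnS_pos n m : 0 < m.+1 %% n -> m.+1 %% n = (m %% n).+1.
Proof. by rewrite modnS; case: ifP. Qed.

Lemma rank3_edge n x a b c (h := fun a' => (a' + x) %% n) :
    a.+1 < n -> b < n -> c < n ->
  if a < h a then rank3 n (h a.+1) a.+1 b c < rank3 n (h a) a b c
  else rank3 n (h a) a b c < rank3 n (h a.+1) a.+1 b c.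
Proof.
move=> an bn cn; have n0 : 0 < n by lia.
have hn a' : h a' < n by rewrite ltn_mod.
have hS : h a.+1 = (h a).+1 %% n.
  by rewrite /h addSn -[in RHS]addn1 modnDml addn1.
case: ltnP => ah.
  apply: rank3_lt => //; first by lia.
    by rewrite hn andbT; lia.
  by rewrite leqNgt ah.
(* No wrap here: [h a <= a] and [a.+1 < n]. *)
have hS' : h a.+1 = (h a).+1 by rewrite hS modn_small //; lia.
apply: rank3_lt => //; first by lia.
  by rewrite hn hS'.
by rewrite hS' ltnS ah.
Qed.

(** [x] gathers what is constant along the line in the sum defining the height. *)
Definition line_rank n x b c (a : 'I_n) : nat := rank3 n ((a + x) %% n) a b c.

Lemma line_rank_neq n x b c (a a' : 'I_n) : b < n -> c < n ->
  consecutive a a' -> line_rank x b c a != line_rank x b c a'.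
Proof.
move=> bn cn; wlog e : a a' / a = a'.+1 :> nat.
  move=> IH /orP[] /eqP[] e.
    by rewrite IH // /consecutive /Defs.coord e eqxx.
  by rewrite eq_sym IH // /consecutive /Defs.coord e eqxx.
move=> _.
have := @rank3_edge n x a' b c; rewrite /line_rank -e ltn_ord bn cn.
by case: ifP => _ /(_ erefl erefl erefl); rewrite ltn_neqAle => /andP[];
  rewrite // eq_sym.
Qed.

Lemma line_rank_lower n x b c (a : 'I_n) :
    b < n -> c < n -> (a + x) %% n != 0 ->
  exists lo : 'I_n, forall a',
    (consecutive a a' && (line_rank x b c a' < line_rank x b c a)) = (a' == lo).
Proof.
move=> bn cn; rewrite -lt0n => h0.
have n0 : 0 < n by have := ltn_ord a; lia.
have hn : (a + x) %% n < n by rewrite ltn_mod.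
have an := ltn_ord a.
(* The residue h lies strictly between 0 and n: h <= a forces a > 0, and a < h forces a + 1 < n, so
   the chosen end is a true neighbour. *)
have lo_lt : (if (a + x) %% n <= a then a.-1 else a.+1) < n by case: ifP; lia.
exists (Ordinal lo_lt) => a'.
rewrite -val_eqE /= /consecutive /Defs.coord !eqSS.
have [e|neq1] := eqVneq (a : nat) a'.+1.
  have := @rank3_edge n x a' b c.
  rewrite /line_rank -e an bn cn => /(_ erefl erefl erefl).
  (* The residue at [a'] is one less than at [a], so both ends agree on the direction of the
     edge. *)
  have -> : (a <= (a' + x) %% n) = ~~ ((a + x) %% n <= a).
    move: h0; rewrite e addSn => h0; rewrite (modnS_pos h0); lia.
  by case: (leqP ((a + x) %% n) a) => /= _; lia.
have [e|neq2] := eqVneq (a' : nat) a.+1.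
  have := @rank3_edge n x a b c.
  rewrite /line_rank -e ltn_ord bn cn => /(_ erefl erefl erefl).
  have -> : (a' <= (a + x) %% n) = ~~ ((a + x) %% n <= a) by rewrite e ltnNge.
  by case: (leqP ((a + x) %% n) a) => /= _; lia.
by case: ifP; lia.
Qed.

(** * From lines to cubes *)

Lemma cube_rankE n t (i j k : 'I_n) :
  [/\ cube_rank t (i, j, k) = line_rank (j + rev_ord k + t) j (rev_ord k) i,
      cube_rank t (i, j, k) = line_rank (i + rev_ord k + t) i (rev_ord k) j
    & cube_rank t (i, j, k) = line_rank (i + j + t) i j (rev_ord k)].
Proof.
rewrite /cube_rank /line_rank /height /=; split.
- by rewrite !addnA.
- by rewrite rank3C !addnA [i + j]addnC.
- by rewrite rank3CA; congr (rank3 _ (_ %% _) _ _ _); rewrite addnCA addnA.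
Qed.

Lemma consecutive_rev n (a b : 'I_n) :
  consecutive (rev_ord a) (rev_ord b) = consecutive a b.
Proof.
by have := ltn_ord a; have := ltn_ord b;
  rewrite /consecutive /Defs.coord /=; lia.
Qed.

Lemma neighbour_cube_rank n t (u v : cube n) :
  neighbour u v -> cube_rank t u != cube_rank t v.
Proof.
case: u v => [[i j] k] [[i' j'] k'].
case/or3P => /and3P[].
- move=> ? /eqP <- /eqP <-; have [-> _ _] := cube_rankE t i j k.
  by have [-> _ _] := cube_rankE t i' j k; apply: line_rank_neq.
- move=> /eqP <- ? /eqP <-; have [_ -> _] := cube_rankE t i j k.
  by have [_ -> _] := cube_rankE t i j' k; apply: line_rank_neq.
- move=> /eqP <- /eqP <- ?; have [_ _ ->] := cube_rankE t i j k.
  by have [_ _ ->] := cube_rankE t i j k'; apply: line_rank_neq;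
    rewrite ?consecutive_rev.
Qed.

(** Each of the three lines through [v] contributes one lower neighbour. *)
Lemma card_lower_neighbours n t (v : cube n) : height t v != 0 ->
  #|[set y | neighbour v y & cube_rank t y < cube_rank t v]| = 3.
Proof.
case: v => [[i j] k] h0.
have [l1 l1P] : exists lo : 'I_n, forall i', (consecutive i i' &&
    (cube_rank t (i', j, k) < cube_rank t (i, j, k))) = (i' == lo).
  have [|||lo loP] := @line_rank_lower n (j + rev_ord k + t) j (rev_ord k) i => //.
    by move: h0; rewrite /height /= !addnA.
  by exists lo => i'; rewrite -loP;
    case: (cube_rankE t i j k) (cube_rankE t i' j k) => -> _ _ [-> _ _].
have [l2 l2P] : exists lo : 'I_n, forall j', (consecutive j j' &&
    (cube_rank t (i, j', k) < cube_rank t (i, j, k))) = (j' == lo).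
  have [|||lo loP] := @line_rank_lower n (i + rev_ord k + t) i (rev_ord k) j => //.
    by move: h0; rewrite /height /= !addnA [j + i]addnC.
  by exists lo => j'; rewrite -loP;
    case: (cube_rankE t i j k) (cube_rankE t i j' k) => _ -> _ [_ -> _].
have [l3 l3P] : exists lo : 'I_n, forall k', (consecutive k k' &&
    (cube_rank t (i, j, k') < cube_rank t (i, j, k))) = (k' == lo).
  have [|||lo loP] := @line_rank_lower n (i + j + t) i j (rev_ord k) => //.
    by move: h0; rewrite /height /= addnCA addnA.
  exists (rev_ord lo) => k';
  rewrite -(can_eq rev_ordK k') rev_ordK -loP consecutive_rev.
  by case: (cube_rankE t i j k) (cube_rankE t i j k') => _ _ -> [_ _ ->].
have irr (a : 'I_n) : consecutive a a = false.
  by rewrite /consecutive /Defs.coord; lia.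
have -> : [set y | neighbour (i, j, k) y & cube_rank t y < cube_rank t (i, j, k)]
  = [set (l1, j, k); (i, l2, k); (i, j, l3)].
  apply/setP => -[[i' j'] k']; rewrite !inE !xpair_eqE.
  rewrite -l1P -l2P -l3P.
  have [<-|] := eqVneq i i'; have [<-|] := eqVneq j j';
    have [<-|] := eqVneq k k';
    rewrite ?irr ?ltnn ?andbF ?orbF //=;
    by do ?move=> /negPf ->; rewrite ?irr ?eqxx ?andbF ?andbT ?orbF.
have /andP[/negPf n1 /negPf n2] : (l1 != i) && (l2 != j).
  by rewrite eq_sym -l1P irr eq_sym -l2P irr.
by rewrite -setUA !cardsU1 !cards1 !inE !xpair_eqE n1 n2 ?andbF.
Qed.

(** * The base as the zero set of the height *)

Lemma shifted_cyclic_baseE n s :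
  shifted_cyclic_base n s =
  [set v | height `|((s + 1) %% Posz n)%Z|%N v == 0].
Proof.
apply/setP => -[[i j] k]; rewrite !inE /height /=.
have n0 : Posz n != 0%R by case: n i {j k} => [[]|].
set t := `|_|%N.
have et : Posz t = ((s + 1) %% Posz n)%Z by rewrite /t gez0_abs ?modz_ge0.
rewrite eqz_mod_dvd -[RHS]/(Posz n %| Posz (i + j + rev_ord k + t))%Z.
have es := divz_eq (s + 1)%R (Posz n); rewrite -et in es.
set q := ((s + 1) %/ Posz n)%Z in es.
(* [rev_ord k] is n - 1 - k; its -1 explains the offset s + 1 instead of s. *)
have -> : Posz (i + j + rev_ord k + t) =
    (Posz (Defs.coord i) + Posz (Defs.coord j) - Posz (Defs.coord k) - (1 - s)
     + (1 - q) * Posz n)%R.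
  rewrite mulrBl mul1r /Defs.coord /=; have := ltn_ord k; lia.
by rewrite [RHS]rpredDr //; apply: dvdz_mull.
Qed.

Lemma card_height n t : #|[set v : cube n | height t v == 0]| = n ^ 2.
Proof.
have [n0|n0] := posnP n.
  have -> : [set v : cube n | height t v == 0] = set0.
    by apply/setP => -[[i j] k]; have := ltn_ord k; lia.
  by rewrite cards0 n0.
(* Height 0 solved for the third coordinate: the base is the graph of a function of the first
   two. *)
have lift_lt (p : 'I_n * 'I_n) : (p.1 + p.2 + n.-1 + t) %% n < n.
  by rewrite ltn_mod.
pose lift (p : 'I_n * 'I_n) : cube n := (p, Ordinal (lift_lt p)).
have -> : [set v : cube n | height t v == 0] = lift @: [set: 'I_n * 'I_n].
  have heightP p (k : 'I_n) : (height t (p, k) == 0) = (k == Ordinal (lift_lt p)).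
    have kn := ltn_ord k; rewrite -val_eqE /=.
    rewrite -[X in _ = (X == _)](modn_small kn) [RHS]eq_sym.
    rewrite eqn_mod_dvd; last by lia.
    by congr (_ %% _ == 0); rewrite /=; lia.
  apply/setP => -[p k]; rewrite inE heightP.
  apply/eqP/imsetP => [->|[p' _ [-> ->]]//]; by exists p.
by rewrite card_imset ?cardsT ?card_prod ?card_ord // => p p' [].
Qed.

Theorem theorem5 (n : nat) (hn : (1 <= n)%N) (s : int) :
  solution (shifted_cyclic_base n s).
Proof.
rewrite shifted_cyclic_baseE; set t := `|_|%N; set B := [set _ | _].
have rankB v : (v \in B) = (cube_rank t v == 0).
  by rewrite inE rank3_eq0 // ltn_mod.
apply/andP; split; last first.
  apply: (connect_dismantling_rank rankB); first exact: neighbour_cube_rank.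
  by move=> v; rewrite inE; apply: card_lower_neighbours.
rewrite /base_position card_height eqxx.
(* Base cubes all have rank 0, whereas neighbours have distinct ranks. *)
apply/forall_inP => u uB; apply/forall_inP => v; move: uB; rewrite !rankB.
move=> /eqP u0 /eqP v0; apply/negP => /(neighbour_cube_rank t).
by rewrite u0 v0.
Qed.
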